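(* Assume $Y=X\beta_\star+\epsilon$ with $\epsilon\sim N(0,\sigma_\star^2 I_n)$, where $\sigma_\star^2>0$ is known. Assume $X\in\mathbb R^{n\times p}$ has nonzero, pairwise orthogonal columns $x_1,\dots,x_p$. Let $s=|\{j:\beta_{\star,j}\neq0\}|$ and assume $\log s\ge 1$. Fix a constant $c_0>2$ and set $z_\star=c_0\log p$. Let $\tilde\beta_n$ be the thresholded SBL estimator defined below. Then \[\|\tilde\beta_n-\beta_\star\|_2^2\le M\,\frac{\sigma_\star^2\, s\log p}{n}\] with probability at least $1-p^{-c_0 s/8}-e^{-s}$, where $M=\frac{4(2+c_0)}{c}$ and $c=\min_{1\le j\le p}\|x_j\|^2/n$.
   Context: Here $\sigma^2=\sigma_\star^2$ throughout. For $\gamma\in[0,\infty)^p$ let $I_\gamma=\{j:\gamma_j\neq0\}$, and define $C_\gamma=\sigma^2 I_n+\sum_{j\in I_\gamma}\gamma_j x_jx_j'$ and $\ell(\sigma^2,\gamma)=-\tfrac12\log\det(C_\gamma)-\tfrac12\operatorname{Tr}(C_\gamma^{-1}YY')$. SBL hyperparameter estimate: $\hat\gamma_n$ is a maximizer of $\gamma\mapsto\ell(\sigma^2,\gamma)$ over $[0,\infty)^p$. Under the orthogonality assumption it is given by $\hat\gamma_{n,j}=(\langle x_j,Y\rangle^2-\sigma^2\|x_j\|^2)/\|x_j\|^4$ if $\langle x_j,Y\rangle^2>\sigma^2\|x_j\|^2$, and $\hat\gamma_{n,j}=0$ otherwise. Thresholded version: $\tilde\gamma_{n,j}=\hat\gamma_{n,j}$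 if $\hat\gamma_{n,j}>\sigma^2 z_\star/\|x_j\|^2$, and $\tilde\gamma_{n,j}=0$ otherwise. Estimator (posterior mean): for $\gamma\in[0,\infty)^p$, the posterior mean $\mu_\gamma\in\mathbb R^p$ has $\mu_{\gamma,j}=0$ for $j\notin I_\gamma$, and $(\mu_{\gamma,j})_{j\in I_\gamma}=(X_\gamma'X_\gamma+\sigma^2\bar\Gamma_\gamma^{-1})^{-1}X_\gamma'Y$. Here $X_\gamma$ is the submatrix of columns of $X$ indexed by $I_\gamma$, and $\bar\Gamma_\gamma=\operatorname{diag}(\gamma_j, j\in I_\gamma)$. Finally, $\tilde\beta_n=\mu_{\tilde\gamma_n}$. *)

(* Defs.v *)
From HB Require Import structures.
From mathcomp Require Import all_boot all_order all_algebra.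
From mathcomp Require Import all_classical all_reals all_analysis.
Set Implicit Arguments. Unset Strict Implicit. Unset Printing Implicit Defensive.
Import Order.TTheory GRing.Theory Num.Theory.
Local Open Scope classical_set_scope.
Local Open Scope ring_scope.

Section SBL.
Variable R : realType.

Definition colnorm2 n p (X : 'M[R]_(n, p)) (j : 'I_p) : R :=
  \sum_(i < n) X i j ^+ 2.

Definition colinner n p (X : 'M[R]_(n, p)) (j : 'I_p) (Y : 'cV[R]_n) : R :=
  \sum_(i < n) X i j * Y i 0.

Definition orthogonal_nonzero_cols n p (X : 'M[R]_(n, p)) : Prop :=
  (forall j : 'I_p, col j X != 0) /\
  (forall j k : 'I_p, j != k -> \sum_(i < n) X i j * X i k = 0).

(* c = min_j ||x_j||^2 / n.  The neutral element of the big min is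
   the sum of all the (nonnegative) terms, which is >= each term, so for
   p >= 1 this is exactly the minimum over j. *)
Definition cmin n p (X : 'M[R]_(n, p)) : R :=
  \big[Num.min/ \sum_(j < p) colnorm2 X j / n%:R]_(j < p) (colnorm2 X j / n%:R).

(* SBL hyperparameter estimate (closed form valid under orthogonality),
   sigma2 = sigma_star^2 *)
Definition gamma_hat n p (sigma2 : R) (X : 'M[R]_(n, p)) (Y : 'cV[R]_n)
  (j : 'I_p) : R :=
  if sigma2 * colnorm2 X j < colinner X j Y ^+ 2
  then (colinner X j Y ^+ 2 - sigma2 * colnorm2 X j) / colnorm2 X j ^+ 2
  else 0.

Definition gamma_tilde n p (sigma2 zstar : R) (X : 'M[R]_(n, p))
  (Y : 'cV[R]_n) (j : 'I_p) : R :=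
  if sigma2 * zstar / colnorm2 X j < gamma_hat sigma2 X Y j
  then gamma_hat sigma2 X Y j else 0.

Definition supp p (g : 'I_p -> R) : {set 'I_p} := [set j | g j != 0].

(* posterior mean mu_gamma: zero off I_gamma, and on I_gamma
   (X_g' X_g + sigma2 Gbar_g^{-1})^{-1} X_g' Y,
   where X_g is the submatrix of the columns indexed by I_gamma
   (enumerated by enum_val) and Gbar_g = diag(gamma_j, j in I_gamma). *)
Definition post_mean n p (sigma2 : R) (X : 'M[R]_(n, p)) (Y : 'cV[R]_n)
  (g : 'I_p -> R) : 'cV[R]_p :=
  let I := supp g in
  let f : 'I_#|I| -> 'I_p := fun k => enum_val k in
  let Xg : 'M[R]_(n, #|I|) := colsub f X in
  let Gbar : 'M[R]_#|I| := diag_mx (\row_(k < #|I|) g (f k)) in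
  let m : 'cV[R]_#|I| := invmx (Xg^T *m Xg + sigma2 *: invmx Gbar) *m (Xg^T *m Y) in
  \col_(j < p) \sum_(k < #|I|) (f k == j)%:R * m k 0.

Definition beta_tilde n p (sigma2 zstar : R) (X : 'M[R]_(n, p))
  (Y : 'cV[R]_n) : 'cV[R]_p :=
  post_mean sigma2 X Y (gamma_tilde sigma2 zstar X Y).

Definition mutually_independent d (T : measurableType d) (P : probability T R)
  n (eps : 'I_n -> T -> R) : Prop :=
  forall B : 'I_n -> set R, (forall i, measurable (B i)) ->
    P (\bigcap_(i in [set: 'I_n]) (eps i @^-1` B i)) =
    (\prod_(i < n) P (eps i @^-1` B i))%E.

(* eps_i ~ N(0, sigma^2), sigma the standard deviation *)
Definition normal_rv d (T : measurableType d) (P : probability T R)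
  (sigma : R) (e : T -> R) : Prop :=
  forall B : set R, measurable B -> P (e @^-1` B) = normal_prob 0 sigma B.

End SBL.

(* Main.v *)
Require Import Defs.
From HB Require Import structures.
From mathcomp Require Import all_boot all_order all_algebra.
From mathcomp Require Import all_classical all_reals all_analysis.
From mathcomp Require Import measurable_realfun.
From mathcomp Require Import ring lra.
Import Order.TTheory GRing.Theory Num.Theory.
Local Open Scope classical_set_scope.
Local Open Scope ring_scope.

(* With z_j = <x_j, eps> / (sigma |x_j|), a thresholded coordinate contributes to the
   error, up to the factor sigma^2 / |x_j|^2, at most 2 (1 + z_star) + 2 z_j^2 on the
   support of beta_star and at most (z_j^2 - 1) 1{z_j^2 > 1 + z_star} off it.  A Chernoff
   bound with parameter of order 1 / log p shows that these contributions exceed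
   their budget with probability at most e^{-s}, already within the allowed failure.

   The joint law of the z_j is used only through its moment generating function,
   which orthogonality of the columns makes that of independent standard normals:
   the functions of z_j in the Chernoff bound are dominated by positive mixtures of
   exponentials, and Tonelli integrates the mixtures out one coordinate at a time. *)

Set Implicit Arguments. Unset Strict Implicit.

(** * Gaussian integrals of exponentials of quadratics *)

(** Completing the square: with [v = 1 - 2 * a * sigma ^+ 2] the integrand is a constant times the
    normal density of mean [b * sigma ^+ 2 / v] and standard deviation [sigma / Num.sqrt v]. *)
Lemma integral_normal_pdf_expR (R : realType) (sigma a b : R) :
  0 < sigma -> 0 < 1 - 2 * a * sigma ^+ 2 ->
  (\int[lebesgue_measure]_x
     (normal_pdf 0 sigma x * expR (a * x ^+ 2 + b * x))%:E =
   ((Num.sqrt (1 - 2 * a * sigma ^+ 2))^-1 *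
     expR (b ^+ 2 * sigma ^+ 2 / (2 * (1 - 2 * a * sigma ^+ 2))))%:E)%E.
Proof.
move=> s0; move vE : (1 - _) => v v0.
have sv0 : 0 < Num.sqrt v by rewrite sqrtr_gt0.
have svE : Num.sqrt v ^+ 2 = v by rewrite sqr_sqrtr// ltW.
have peakE : normal_peak (sigma / Num.sqrt v) = normal_peak sigma * Num.sqrt v.
  rewrite /normal_peak.
  rewrite (_ : (sigma / Num.sqrt v) ^+ 2 * pi *+ 2 = (sigma ^+ 2 * pi *+ 2) / v); last first.
    by rewrite expr_div_n svE -mulrA (mulrC v^-1) mulrA mulrnAl.
  rewrite sqrtrM; last by rewrite mulrn_wge0// mulr_ge0 ?sqr_ge0 ?pi_ge0.
  by rewrite sqrtrV ?ltW// invfM invrK.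
have expE x : expR (- (x - 0) ^+ 2 / (sigma ^+ 2 *+ 2)) * expR (a * x ^+ 2 + b * x) =
    expR (b ^+ 2 * sigma ^+ 2 / (2 * v)) *
    expR (- (x - b * sigma ^+ 2 / v) ^+ 2 / ((sigma / Num.sqrt v) ^+ 2 *+ 2)).
  rewrite -!expRD expr_div_n svE; congr expR.
  have aE : a = (1 - v) / (2 * sigma ^+ 2).
    by rewrite -vE; field; rewrite gt_eqF.
  by rewrite aE; field; rewrite !gt_eqF.
set K := _^-1 * _.
have E x : normal_pdf 0 sigma x * expR (a * x ^+ 2 + b * x) =
    K * normal_pdf (b * sigma ^+ 2 / v) (sigma / Num.sqrt v) x.
  rewrite /normal_pdf !gt_eqF ?divr_gt0// /normal_fun peakE -[LHS]mulrA expE /K.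
  move: (expR _) (expR _) (normal_peak _) => p q r.
  by field; rewrite gt_eqF.
under eq_integral do rewrite E EFinM.
rewrite ge0_integralZl_EFin//=.
- by rewrite integral_normal_pdf mule1.
- by move=> x _; rewrite lee_fin normal_pdf_ge0.
- by apply/measurable_EFinP; exact: measurable_normal_pdf.
- by rewrite /K mulr_ge0 ?expR_ge0// invr_ge0 ltW.
Qed.

(** * Layer cake and comparison of integrals *)

Lemma measurable_layer (d : measure_display) (T : measurableType d) (R : realType)
    (W g : T -> R) : measurable_fun setT W -> measurable_fun setT g ->
  measurable_fun setT
    (fun p : T * measurableTypeR R => (W p.1 * \1_`[0, g p.1[%classic p.2)%:E).
Proof.
move=> mW mg; apply/measurable_EFinP.
apply: measurable_funM; first exact: measurableT_comp.
apply: measurable_indic.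
pose f1 (p : T * measurableTypeR R) := (0 <= p.2)%R.
pose f2 (p : T * measurableTypeR R) := (p.2 < g p.1)%R.
rewrite [X in measurable X](_ : _ =
    f1 @^-1` [set true] `&` f2 @^-1` [set true]); last first.
  by apply/seteqP; split => p; rewrite /= in_itv/= => /andP.
apply: measurableI.
- have : measurable_fun setT f1 by exact: measurable_fun_ler.
  by move=> /(_ measurableT [set true]); rewrite setTI; exact.
- have : measurable_fun setT f2.
    by apply: measurable_fun_ltr => //; exact: measurableT_comp mg _.
  by move=> /(_ measurableT [set true]); rewrite setTI; exact.
Qed.

(** [g x] is the length of [[0, g x[], so Tonelli turns the integral of [W * g] into an integral
    over the level [y]. *)
Lemma integral_layer_cake (d : measure_display) (T : measurableType d) (R : realType)
    (mu : {sigma_finite_measure set T -> \bar R}) (W g : T -> R) :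
  (forall x, 0 <= W x) -> measurable_fun setT W ->
  (forall x, 0 <= g x) -> measurable_fun setT g ->
  (\int[mu]_x (W x * g x)%:E =
   \int[lebesgue_measure]_y \int[mu]_x (W x * \1_`[0%R, g x[%classic y)%:E)%E.
Proof.
move=> W0 mW g0 mg.
rewrite -(fubini_tonelli
  (fun p : T * measurableTypeR R => (W p.1 * \1_`[0%R, g p.1[%classic p.2)%:E))/=.
- apply: eq_integral => x _.
  under eq_integral do rewrite EFinM.
  rewrite ge0_integralZl_EFin//=; last by apply/measurable_EFinP/measurable_indic.
  rewrite integral_indic//= setIT lebesgue_measure_itv/= EFinM; congr (_ * _)%E.
  rewrite lte_fin; case: ltP => [|gx]; first by rewrite oppr0 adde0.
  by congr EFin; apply/eqP; rewrite eq_le g0 gx.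
- exact: measurable_layer.
- by move=> p; rewrite lee_fin mulr_ge0.
Qed.

(** By the layer cake formula, the comparison on indicators, applied to the superlevel sets of [f],
    integrates to a comparison for [f] itself. *)
Lemma le_integral_of_le_indic (d1 d2 : measure_display)
    (T1 : measurableType d1) (T2 : measurableType d2) (R : realType)
    (mu1 : {sigma_finite_measure set T1 -> \bar R})
    (mu2 : {sigma_finite_measure set T2 -> \bar R})
    (W1 e1 : T1 -> R) (W2 e2 : T2 -> R) (f : R -> R) :
  (forall x, 0 <= W1 x) -> measurable_fun setT W1 -> measurable_fun setT e1 ->
  (forall x, 0 <= W2 x) -> measurable_fun setT W2 -> measurable_fun setT e2 ->
  (forall r, 0 <= f r) -> measurable_fun setT f ->
  (forall B : set R, measurable B ->
    (\int[mu1]_x (W1 x * \1_B (e1 x))%:E <= \int[mu2]_x (W2 x * \1_B (e2 x))%:E)%E) ->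
  (\int[mu1]_x (W1 x * f (e1 x))%:E <= \int[mu2]_x (W2 x * f (e2 x))%:E)%E.
Proof.
move=> W10 mW1 me1 W20 mW2 me2 f0 mf le12.
have mf1 : measurable_fun setT (fun x => f (e1 x)) by exact: measurableT_comp.
have mf2 : measurable_fun setT (fun x => f (e2 x)) by exact: measurableT_comp.
rewrite !integral_layer_cake//.
apply: ge0_le_integral => //.
- by move=> y _; apply: integral_ge0 => x _; rewrite lee_fin mulr_ge0.
- apply: (measurable_fun_fubini_tonelli_G (fun p : T1 * measurableTypeR R =>
    (W1 p.1 * \1_`[0%R, f (e1 p.1)[%classic p.2)%:E)) => [|p].
    exact: measurable_layer mW1 mf1.
  by rewrite lee_fin mulr_ge0.
- apply: (measurable_fun_fubini_tonelli_G (fun p : T2 * measurableTypeR R =>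
    (W2 p.1 * \1_`[0%R, f (e2 p.1)[%classic p.2)%:E)) => [|p].
    exact: measurable_layer mW2 mf2.
  by rewrite lee_fin mulr_ge0.
move=> y _.
pose B : set R := [set r | 0 <= y < f r].
have indE z : \1_`[0, f z[%classic y = \1_B z :> R.
  by rewrite !indicE (_ : (y \in `[0, f z[%classic) = (z \in B))//.
under eq_integral do rewrite indE.
under [leRHS]eq_integral do rewrite indE.
apply: le12.
(* For [y >= 0] the set [B] is the superlevel set of [f] at [y]; for [y < 0] it is empty. *)
have := mf measurableT `]y, +oo[%classic (measurable_itv _).
rewrite setTI => mB.
have [y0|y0] := leP 0 y.
  rewrite (_ : B = f @^-1` `]y, +oo[%classic)//.
  by apply/seteqP; split=> r /=; rewrite /B/= in_itv/= y0 andbT.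
rewrite (_ : B = set0)//; apply/seteqP; split=> r //=; rewrite /B/=.
by rewrite leNgt y0.
Qed.

(* The factors are exchanged one at a time, the remaining ones serving as the weight [W]. *)
Lemma le_integral_prod_extend (d : measure_display) (T : measurableType d) (R : realType)
    (mu : {measure set T -> \bar R}) (I : finType) (x : I -> T -> R)
    (A : I -> (R -> R) -> R -> Prop) (phi : I -> R -> R) (m : I -> R) :
  (forall i, measurable_fun setT (x i)) ->
  (forall i, exists h : (R -> R) * R, A i h.1 h.2) ->
  (forall i h H, A i h H -> [/\ forall r, 0 <= h r, measurable_fun setT h & 0 <= H]) ->
  (forall i, [/\ forall r, 0 <= phi i r, measurable_fun setT (phi i) & 0 <= m i]) ->
  (forall h H, (forall i, A i (h i) (H i)) ->
    (\int[mu]_w (\prod_i h i (x i w))%:E <= (\prod_i H i)%:E)%E) ->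
  (forall i (W : T -> R) (c : R), (forall w, 0 <= W w) -> measurable_fun setT W -> 0 <= c ->
    (forall h H, A i h H -> (\int[mu]_w (W w * h (x i w))%:E <= (c * H)%:E)%E) ->
    (\int[mu]_w (W w * phi i (x i w))%:E <= (c * m i)%:E)%E) ->
  (\int[mu]_w (\prod_i phi i (x i w))%:E <= (\prod_i m i)%:E)%E.
Proof.
move=> mx Aex Apos phipos Aprod swap.
(* The induction runs over the list of exchanged indices and keeps the other test functions
   arbitrary, since [swap] at [k] asks for the bound with every test function at [k]. *)
suff H (r : seq I) : uniq r -> forall h H, (forall i, A i (h i) (H i)) ->
    (\int[mu]_w (\prod_i (if i \in r then phi i else h i) (x i w))%:E <=
     (\prod_i (if i \in r then m i else H i))%:E)%E.
  have [h Ah] := choice Aex.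
  have := H _ (enum_uniq I) (fun i => (h i).1) (fun i => (h i).2) Ah.
  under eq_integral do under eq_bigr do rewrite mem_enum.
  by under [(\prod_i _)%R in leRHS]eq_bigr do rewrite mem_enum.
elim: r => [_ h H AhH|k r IH /= /andP[kr ur] h H AhH].
  exact: Aprod.
have ikr i : i != k -> (i \in k :: r) = (i \in r) by rewrite inE => /negbTE->.
under eq_integral => w _.
  rewrite (bigD1 k)//= mem_head mulrC.
  under eq_bigr => i ik do rewrite ikr//.
  over.
rewrite [in leRHS](bigD1 k)//= mem_head mulrC.
under [(\prod_(i | _) _)%R in leRHS]eq_bigr => i ik do rewrite ikr//.
have good i : [/\ forall r', 0 <= (if i \in r then phi i else h i) r',
    measurable_fun setT (if i \in r then phi i else h i) &
    0 <= if i \in r then m i else H i].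
  by case: ifP => _; [exact: phipos|exact: Apos].
apply: (swap k (fun w => \prod_(i | i != k) (if i \in r then phi i else h i) (x i w))) => [w|||h' H' Ah'].
- by apply: prodr_ge0 => i _; have [] := good i.
- under eq_fun do rewrite -big_filter.
  apply: measurable_prod => i _.
  by apply: measurableT_comp => //; have [] := good i.
- by apply: prodr_ge0 => i _; have [] := good i.
have := IH ur (fun i => if i == k then h' else h i) (fun i => if i == k then H' else H i).
under eq_integral => w _.
  rewrite (bigD1 k)//= (negbTE kr) eqxx mulrC.
  under eq_bigr => i ik do rewrite (negbTE ik).
  over.
rewrite [in leRHS](bigD1 k)//= (negbTE kr) eqxx mulrC.
under [(\prod_(i | _) _)%R in leRHS]eq_bigr => i ik do rewrite (negbTE ik).
by apply => i; case: eqP => [->|].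
Qed.

(* Holds with equality when [phi] is a positive mixture of exponentials and [m] its
   expectation under the standard normal law; [W] stands for the factors carried by the
   other coordinates. *)
Definition mgf_dominated (d : measure_display) (T : measurableType d) (R : realType)
    (mu : set T -> \bar R) (x : T -> R) (phi : R -> R) (m : R) : Prop :=
  forall (W : T -> R) (c : R), (forall w, 0 <= W w) -> measurable_fun setT W -> 0 <= c ->
    (forall t, (\int[mu]_w (W w * expR (t * x w))%:E <= (c * expR (t ^+ 2 / 2))%:E)%E) ->
    (\int[mu]_w (W w * phi (x w))%:E <= (c * m)%:E)%E.

(** * Calculus of functions controlled by the moment generating function *)

Section mgf_dominated.
Context (d : measure_display) (T : measurableType d) (R : realType).
Variables (mu : {sigma_finite_measure set T -> \bar R}) (x : T -> R).
Hypothesis mx : measurable_fun setT x.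

(** The constant is the exponential of slope [t = 0]. *)
Lemma mgf_dominated1 : mgf_dominated mu x (fun=> 1) 1.
Proof.
move=> W c _ _ _ /(_ 0); rewrite expr0n mul0r expR0.
by under eq_integral do rewrite mul0r expR0.
Qed.

Lemma mgf_dominatedD (phi psi : R -> R) m1 m2 :
  (forall r, 0 <= phi r) -> measurable_fun setT phi ->
  (forall r, 0 <= psi r) -> measurable_fun setT psi ->
  mgf_dominated mu x phi m1 -> mgf_dominated mu x psi m2 ->
  mgf_dominated mu x (fun r => phi r + psi r) (m1 + m2).
Proof.
move=> phi0 mphi psi0 mpsi H1 H2 W c W0 mW c0 HW.
under eq_integral do rewrite mulrDr EFinD.
rewrite ge0_integralD//=.
- by rewrite mulrDr EFinD leeD//; [exact: H1|exact: H2].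
- by move=> w _; rewrite lee_fin mulr_ge0.
- by apply/measurable_EFinP/measurable_funM => //; exact: measurableT_comp.
- by move=> w _; rewrite lee_fin mulr_ge0.
- by apply/measurable_EFinP/measurable_funM => //; exact: measurableT_comp.
Qed.

Lemma mgf_dominatedZ (phi : R -> R) m (k : R) : 0 <= k ->
  (forall r, 0 <= phi r) -> measurable_fun setT phi ->
  mgf_dominated mu x phi m -> mgf_dominated mu x (fun r => k * phi r) (k * m).
Proof.
move=> k0 phi0 mphi H W c W0 mW c0 HW.
under eq_integral do rewrite mulrCA EFinM.
rewrite ge0_integralZl_EFin//=.
- by rewrite mulrCA EFinM lee_wpmul2l ?lee_fin//; exact: H.
- by move=> w _; rewrite lee_fin mulr_ge0.
- by apply/measurable_EFinP/measurable_funM => //; exact: measurableT_comp.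
Qed.

(* Linearize the square: [expR (a * x ^+ 2)] is the moment generating function at [x]
   of a centered normal law of variance [2 * a], so Tonelli reduces to exponentials. *)
Lemma mgf_dominated_expR_sqr (a b : R) : 0 <= a -> 2 * a < 1 ->
  mgf_dominated mu x (fun r => expR (a * r ^+ 2 + b * r))
    ((Num.sqrt (1 - 2 * a))^-1 * expR (b ^+ 2 / (2 * (1 - 2 * a)))).
Proof.
move=> a0 a1 W c W0 mW c0 HW.
pose s := Num.sqrt (2 * a).
have s2 : s ^+ 2 = 2 * a by rewrite sqr_sqrtr// mulr_ge0.
pose N : R -> R := normal_pdf 0 1.
have N0 g : 0 <= N g by exact: normal_pdf_ge0.
have mN : measurable_fun setT N by exact: measurable_normal_pdf.
have E w : ((W w * expR (a * x w ^+ 2 + b * x w))%:E =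
    \int[lebesgue_measure]_g (W w * expR ((s * g + b) * x w) * N g)%:E)%E.
  under eq_integral => g _.
    rewrite (_ : _ * _ = (W w * expR (b * x w)) * (N g * expR (0 * g ^+ 2 + (s * x w) * g))); last first.
      rewrite mul0r add0r (_ : (s * g + b) * x w = b * x w + s * x w * g); last by ring.
      by rewrite expRD; ring.
    rewrite EFinM; over.
  rewrite ge0_integralZl_EFin//=.
  - rewrite integral_normal_pdf_expR ?mulr0 ?mul0r ?subr0//.
    rewrite -EFinM sqrtr1 invr1 mul1r; congr EFin.
    rewrite -[RHS]mulrA -expRD exprMn s2 expr1n.
    by congr (_ * expR _); field.
  - by move=> g _; rewrite lee_fin mulr_ge0// ?expR_ge0.
  - apply/measurable_EFinP/measurable_funM => //; apply: measurableT_comp => //.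
    by apply: measurable_funD; apply: measurable_funM => //; exact: measurable_funX.
  - by rewrite mulr_ge0 ?expR_ge0.
under eq_integral do rewrite E.
pose F (p : T * measurableTypeR R) := (W p.1 * expR ((s * p.2 + b) * x p.1) * N p.2)%:E.
have F0 p : (0 <= F p)%E by rewrite lee_fin !mulr_ge0// expR_ge0.
have mF : measurable_fun setT F.
  apply/measurable_EFinP; apply: measurable_funM; last exact: measurableT_comp.
  apply: measurable_funM; first exact: measurableT_comp.
  apply: measurableT_comp => //; apply: measurable_funM; last exact: measurableT_comp.
  by apply: measurable_funD => //; apply: measurable_funM.
rewrite (fubini_tonelli F)//.
have vE : 1 - 2 * (s ^+ 2 / 2) * 1 ^+ 2 = 1 - 2 * a by rewrite s2; field.
have v0 : 0 < 1 - 2 * a by lra.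
(* The target constant is written as an integral over [g] too, so that the two integrands can be
   compared at each fixed [g], by the hypothesis at slope [s * g + b]. *)
have RE : (c * ((Num.sqrt (1 - 2 * a))^-1 * expR (b ^+ 2 / (2 * (1 - 2 * a)))))%:E =
  (\int[lebesgue_measure]_g ((c * expR (b ^+ 2 / 2)) *
     (N g * expR ((s ^+ 2 / 2) * g ^+ 2 + (s * b) * g)))%:E)%E.
  under eq_integral do rewrite EFinM.
  rewrite ge0_integralZl_EFin//=.
  - rewrite integral_normal_pdf_expR ?vE// -EFinM; congr EFin.
    rewrite -[RHS]mulrA; congr (_ * _); rewrite [RHS]mulrCA -expRD; congr (_ * expR _).
    rewrite exprMn s2; field.
    by rewrite gt_eqF//; lra.
  - by move=> g _; rewrite lee_fin mulr_ge0// ?expR_ge0.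
  - apply/measurable_EFinP/measurable_funM => //; apply: measurableT_comp => //.
    by apply: measurable_funD; apply: measurable_funM => //; exact: measurable_funX.
  - by rewrite mulr_ge0 ?expR_ge0.
rewrite RE; apply: ge0_le_integral => //=.
- by move=> g _; apply: integral_ge0 => w _; rewrite lee_fin !mulr_ge0 ?expR_ge0.
- exact: (measurable_fun_fubini_tonelli_G F).
- apply/measurable_EFinP/measurable_funM => //; apply: measurable_funM => //.
  apply: measurableT_comp => //.
  by apply: measurable_funD; apply: measurable_funM => //; exact: measurable_funX.
move=> g _.
under eq_integral do rewrite /F/= mulrC EFinM.
rewrite ge0_integralZl_EFin//=.
- apply: (le_trans (lee_wpmul2l _ (HW _))); first by rewrite lee_fin.
  rewrite -EFinM lee_fin le_eqVlt; apply/orP; left; apply/eqP.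
  rewrite -!mulrA mulrCA [_ * (N g * _)]mulrCA; congr (_ * (_ * _)); rewrite -expRD; congr expR.
  by field.
- by move=> w _; rewrite lee_fin mulr_ge0 ?expR_ge0.
- apply/measurable_EFinP/measurable_funM => //; apply: measurableT_comp => //.
  by apply: measurable_funM.
Qed.

End mgf_dominated.

(** * Moment generating functions under independent normal noise *)

(** The hypothesis bounds the image under [x] of the measure weighted by [W] by [c] times the normal
    law; [le_integral_of_le_indic] carries this over to exponentials, whose normal integral is
    explicit. *)
Lemma le_integral_expR_of_normal (d : measure_display) (T : measurableType d) (R : realType)
    (mu : {sigma_finite_measure set T -> \bar R}) (W x : T -> R) (c sigma a : R) :
  0 < sigma -> 0 <= c -> (forall w, 0 <= W w) ->
  measurable_fun setT W -> measurable_fun setT x ->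
  (forall B, measurable B ->
    (\int[mu]_w (W w * \1_B (x w))%:E <= (c * fine (normal_prob 0 sigma B))%:E)%E) ->
  (\int[mu]_w (W w * expR (a * x w))%:E <= (c * expR (a ^+ 2 * sigma ^+ 2 / 2))%:E)%E.
Proof.
move=> s0 c0 W0 mW mx HB.
pose g r := c * normal_pdf 0 sigma r.
have g0 r : 0 <= g r by rewrite mulr_ge0// normal_pdf_ge0.
have mN := measurable_normal_pdf (0 : R) sigma.
have mg : measurable_fun setT g by exact: measurable_funM.
have mexp (b : R) : measurable_fun setT (fun r => expR (b * r)).
  by apply: measurableT_comp => //; exact: measurable_funM.
apply: (le_trans (@le_integral_of_le_indic _ _ _ _ _ mu lebesgue_measure
  W x g id (fun r => expR (a * r)) W0 mW mx g0 mg _ _ _ _)) => //.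
- move=> B mB; apply: (le_trans (HB B mB)).
  under eq_integral do rewrite /g -mulrA EFinM.
  rewrite ge0_integralZl_EFin//=.
  + rewrite EFinM fineK; last exact: fin_num_measure.
    rewrite lee_wpmul2l ?lee_fin// /normal_prob integral_mkcond.
    rewrite le_eqVlt; apply/orP; left; apply/eqP; apply: eq_integral => r _.
    by rewrite patchE indicE; case: ifP => _; rewrite ?mulr1 ?mulr0.
  + by move=> r _; rewrite lee_fin mulr_ge0 ?normal_pdf_ge0.
  + by apply/measurable_EFinP/measurable_funM => //; exact: measurable_indic.
- under eq_integral => r _.
    rewrite /g -mulrA (_ : a * r = 0 * r ^+ 2 + a * r); last by rewrite mul0r add0r.
    rewrite EFinM; over.
  rewrite ge0_integralZl_EFin//=.
  + by rewrite integral_normal_pdf_expR ?mulr0 ?mul0r ?subr0 ?mulr1 ?sqrtr1 ?invr1 ?mul1r ?EFinM.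
  + by move=> r _; rewrite lee_fin mulr_ge0 ?normal_pdf_ge0 ?expR_ge0.
  + apply/measurable_EFinP/measurable_funM => //; apply: measurableT_comp => //.
    by apply: measurable_funD; apply: measurable_funM => //; exact: measurable_funX.
Qed.

Section independent_normal.
Context (d : measure_display) (T : measurableType d) (R : realType).
Variables (P : probability T R) (n : nat) (sigma : R) (eps : 'I_n -> {RV P >-> R}).
Hypotheses (s0 : 0 < sigma) (Neps : forall i, normal_rv P sigma (eps i)).
Hypothesis indep : mutually_independent P (fun i => (eps i : T -> R)).

(** Independence gives the product formula for indicators; these are then exchanged for exponentials
    one coordinate at a time. *)
Lemma independent_normal_mgf (a : 'I_n -> R) :
  (\int[P]_w (\prod_i expR (a i * eps i w))%:E <=
   (\prod_i expR (a i ^+ 2 * sigma ^+ 2 / 2))%:E)%E.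
Proof.
apply: (@le_integral_prod_extend _ _ _ P 'I_n (fun i => eps i : T -> R)
  (fun i h H => exists2 B : set R, measurable B &
     h = \1_B /\ H = fine (normal_prob 0 sigma B))
  (fun i r => expR (a i * r)) (fun i => expR (a i ^+ 2 * sigma ^+ 2 / 2))).
- by move=> i; exact: measurable_funPT.
- by move=> i; exists (\1_setT, fine (normal_prob 0 sigma setT)); exists setT.
- move=> i h H [B mB [-> ->]]; split.
  - by move=> r; rewrite indicE.
  - exact: measurable_indic.
  - by rewrite fine_ge0.
- move=> i; split; [by move=> r; exact: expR_ge0| |exact: expR_ge0].
  by apply: measurableT_comp => //; exact: measurable_funM.
- move=> h H AhH.
  have /choice[B HB] : forall i, exists B : set R,
      measurable B /\ (h i = \1_B /\ H i = fine (normal_prob 0 sigma B)).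
    by move=> i; have [B mB hB] := AhH i; exists B.
  have mB i : measurable (B i) by have [] := HB i.
  have -> : (\prod_i H i)%:E = P (\bigcap_(i in [set: 'I_n]) (eps i @^-1` B i)).
    rewrite indep// -prodEFin; apply: eq_bigr => i _.
    have [_ [_ ->]] := HB i.
    rewrite (Neps i (mB i)) fineK//; apply: fin_num_measure; exact: mB.
  set C := \bigcap_(i in _) _.
  have mC : measurable C.
    apply: fin_bigcap_measurable => // i _.
    by rewrite -[X in measurable X]setTI; exact: measurable_funPT.
  have -> : P C = (\int[P]_w (\1_C w)%:E)%E by rewrite integral_indic// setIT.
  rewrite le_eqVlt; apply/orP; left; apply/eqP.
  apply: eq_integral => w _; congr EFin.
  have -> : \prod_i h i (eps i w) = \prod_i \1_(B i) (eps i w).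
    by apply: eq_bigr => i _; have [_ [-> _]] := HB i.
  rewrite indicE; have [wC|wC] := boolP (w \in C).
    rewrite big1// => i _; rewrite indicE mem_set//.
    by move/set_mem : wC => /(_ i); exact.
  have [i Bi] : exists i, ~ B i (eps i w).
    by apply/existsNP => h'; move/negP : wC; apply; apply/mem_set => i _; exact: h'.
  by rewrite (bigD1 i)//= indicE memNset// mul0r.
- move=> i W c W0 mW c0 HW.
  apply: le_integral_expR_of_normal => //.
  by move=> B mB; apply: HW; exists B.
Qed.

(** A second exchange, from exponentials to the [phi j]: it starts from the joint moment generating
    function of the [z j], and [mgf_dominated] is what each single exchange requires. *)
Lemma orthonormal_normal_prod p (u : 'I_n -> 'I_p -> R) (phi : 'I_p -> R -> R) (m : 'I_p -> R) :
  let z j (w : T) := \sum_i u i j * eps i w in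
  (forall j k, \sum_i u i j * u i k = (j == k)%:R / sigma ^+ 2) ->
  (forall j, [/\ forall r, 0 <= phi j r, measurable_fun setT (phi j), 0 <= m j &
     mgf_dominated P (z j) (phi j) (m j)]) ->
  (\int[P]_w (\prod_j phi j (z j w))%:E <= (\prod_j m j)%:E)%E.
Proof.
move=> z uu Hphi.
have mz j : measurable_fun setT (z j).
  by apply: measurable_sum => i; apply: measurable_funM => //; exact: measurable_funPT.
apply: (@le_integral_prod_extend _ _ _ P 'I_p z
  (fun j h H => exists t, h = (fun r => expR (t * r)) /\ H = expR (t ^+ 2 / 2)) phi m) => //.
- by move=> j; exists (fun r => expR (0 * r), expR (0 ^+ 2 / 2)); exists 0.
- move=> j h H [t [-> ->]]; split; [by move=> r; exact: expR_ge0| |exact: expR_ge0].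
  by apply: measurableT_comp => //; exact: measurable_funM.
- by move=> j; have [] := Hphi j.
- move=> h H /choice[t AhH].
  have hE w : \prod_j h j (z j w) = \prod_i expR ((\sum_j t j * u i j) * eps i w).
    under eq_bigr do rewrite (AhH _).1.
    rewrite -!expR_sum; congr expR; rewrite /z.
    under eq_bigr do rewrite mulr_sumr.
    rewrite exchange_big/=; apply: eq_bigr => i _.
    by rewrite mulr_suml; apply: eq_bigr => j _; rewrite mulrA.
  under eq_integral do rewrite hE.
  apply: (le_trans (independent_normal_mgf _)).
  rewrite lee_fin le_eqVlt; apply/orP; left; apply/eqP.
  under [RHS]eq_bigr do rewrite (AhH _).2.
  rewrite -!expR_sum; congr expR; rewrite -!mulr_suml; congr (_ / _).
  (* In the squared norm of the coefficients, orthonormality removes the cross terms and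
     [sigma ^+ 2] cancels, which leaves the sum of the [t j ^+ 2]. *)
  under eq_bigr => i _.
    rewrite expr2 mulr_suml.
    under eq_bigr do rewrite mulr_sumr.
    over.
  rewrite exchange_big/= mulr_suml; apply: eq_bigr => j _.
  rewrite exchange_big/= (bigD1 j)//= [X in _ + X]big1 ?addr0.
    under eq_bigr do rewrite mulrACA.
    rewrite -mulr_sumr uu eqxx mul1r -mulrA mulVf ?mulr1 ?expr2//.
    by rewrite mulf_neq0// gt_eqF.
  move=> k kj; under eq_bigr do rewrite mulrACA.
  by rewrite -mulr_sumr uu eq_sym (negbTE kj) mul0r mulr0.
- move=> j W c W0 mW c0 HW; have [_ _ _] := Hphi j; apply => // t.
  exact: (HW (fun r => expR (t * r)) (expR (t ^+ 2 / 2)) (ex_intro _ t (conj erefl erefl))).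
Qed.

End independent_normal.

(** * Closed form and coordinatewise error under orthogonality *)

Section closed_form.
Context (R : realType) (n p : nat).
Implicit Types (X : 'M[R]_(n, p)) (Y : 'cV[R]_n).

Lemma colnorm2_gt0 X j : orthogonal_nonzero_cols X -> 0 < colnorm2 X j.
Proof.
move=> [/(_ j) Xj _]; rewrite lt_def; apply/andP; split; last first.
  by apply: sumr_ge0 => i _; exact: sqr_ge0.
apply: contra Xj => /eqP; rewrite /colnorm2 => /psumr_eq0P h.
apply/eqP/matrixP => i k; rewrite !mxE; apply/eqP; rewrite -sqrf_eq0; apply/eqP.
by apply: h => // i' _; exact: sqr_ge0.
Qed.

(** The Gram matrix of orthogonal columns is diagonal, hence so is the matrix to invert, and the
    posterior mean decouples over coordinates. *)
Lemma post_mean_orthogonal (sigma2 : R) X Y (g : 'I_p -> R) j :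
  orthogonal_nonzero_cols X -> 0 < sigma2 -> (forall k, 0 <= g k) ->
  post_mean sigma2 X Y g j 0 =
  if g j != 0 then colinner X j Y / (colnorm2 X j + sigma2 / g j) else 0.
Proof.
move=> hX s0 g0; rewrite /post_mean mxE.
set I := supp g; set f := fun k : 'I_#|I| => enum_val k.
have gf k : g (f k) != 0 by have := enum_valP k; rewrite inE.
have dpos k : 0 < colnorm2 X (f k) + sigma2 / g (f k).
  by rewrite addr_gt0 ?colnorm2_gt0// divr_gt0// lt_def gf g0.
set D := _^T *m _ + _.
have GE : invmx (diag_mx (\row_(k < #|I|) g (f k))) = diag_mx (\row_(k < #|I|) (g (f k))^-1).
  have Gu : diag_mx (\row_(k < #|I|) g (f k)) \in unitmx.
    by rewrite unitmxE det_diag unitfE; apply/prodf_neq0 => k _; rewrite mxE.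
  apply: (can_inj (mulKmx Gu)); rewrite mulmxV//.
  apply/matrixP => k l; rewrite mul_diag_mx !mxE.
  by case: eqP => [->|]; rewrite ?mulr1n ?mulr0n ?mulr0// mulfV.
have DE : D = diag_mx (\row_k (colnorm2 X (f k) + sigma2 / g (f k))).
  apply/matrixP => k l; rewrite /D GE !mxE.
  under eq_bigr do rewrite !mxE.
  case: eqVneq => [->|kl].
    by rewrite !mulr1n; congr (_ + _); apply: eq_bigr => i _; rewrite expr2.
  rewrite !mulr0n mulr0 addr0; case: hX => _; apply.
  by apply: contra kl => /eqP/enum_val_inj ->.
have Du : D \in unitmx.
  by rewrite DE unitmxE det_diag unitfE; apply/prodf_neq0 => k _; rewrite mxE gt_eqF.
have mE : invmx D *m ((colsub f X)^T *m Y) =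
    \col_k (colinner X (f k) Y / (colnorm2 X (f k) + sigma2 / g (f k))).
  apply: (can_inj (mulKmx Du)); rewrite mulKVmx// DE.
  apply/matrixP => k l; rewrite mul_diag_mx !mxE mulrC divfK ?gt_eqF//.
  by rewrite (ord1 l); apply: eq_bigr => i _; rewrite !mxE.
rewrite mE; case: ifPn => [gj|gj].
  have jI : j \in I by rewrite inE.
  rewrite (bigD1 (enum_rank_in jI j))//= big1 ?addr0.
    by rewrite /f enum_rankK_in// eqxx mul1r mxE /f enum_rankK_in.
  move=> k kj; case: eqP => [fk|]; rewrite ?mul0r//.
  by case/eqP: kj; apply: enum_val_inj; rewrite enum_rankK_in.
rewrite big1// => k _; case: eqP => [fk|]; rewrite ?mul0r//.
by move: gj; rewrite -fk gf.
Qed.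

(** For [zstar >= 0] the cut in [gamma_tilde] implies the one in [gamma_hat], so the two merge into
    a single threshold on the squared inner product. *)
Lemma beta_tilde_orthogonal (sigma2 zstar : R) X Y j :
  orthogonal_nonzero_cols X -> 0 < sigma2 -> 0 <= zstar ->
  beta_tilde sigma2 zstar X Y j 0 =
  if sigma2 * (1 + zstar) * colnorm2 X j < colinner X j Y ^+ 2
  then (colinner X j Y ^+ 2 - sigma2 * colnorm2 X j) / (colnorm2 X j * colinner X j Y)
  else 0.
Proof.
move=> hX s0 z0; rewrite /beta_tilde post_mean_orthogonal//; last first.
  move=> k; rewrite /gamma_tilde /gamma_hat.
  case: ifP => // _; case: ifP => // h.
  by rewrite divr_ge0 ?sqr_ge0// subr_ge0 ltW.
have N0 := colnorm2_gt0 j hX.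
rewrite /gamma_tilde /gamma_hat.
move: (colnorm2 X j) (colinner X j Y) N0 => N q N0.
have [h1|h1] := ltP (sigma2 * N) (q ^+ 2); last first.
  rewrite if_same eqxx/= ifF//; apply/negbTE; rewrite -leNgt (le_trans h1)//.
  by rewrite mulrDr mulr1 mulrDl lerDl !mulr_ge0// ltW.
have qN : 0 < q ^+ 2 - sigma2 * N by rewrite subr_gt0.
have q0 : q != 0 by apply: contraTneq h1 => ->; rewrite expr0n/= -leNgt mulr_ge0// ltW.
have -> : (sigma2 * zstar / N < (q ^+ 2 - sigma2 * N) / N ^+ 2) =
          (sigma2 * (1 + zstar) * N < q ^+ 2).
  rewrite ltr_pdivrMr// expr2 invfM mulrA divfK ?gt_eqF// ltr_pdivlMr//.
  by rewrite ltrBrDl; congr (_ < _); ring.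
have [_|_] := ltP (sigma2 * (1 + zstar) * N) (q ^+ 2); last by rewrite eqxx.
rewrite gt_eqF ?divr_gt0 ?exprn_gt0//=.
(* The denominator met by [field] collapses to a product that is visibly nonzero. *)
have Nq : N * (q ^+ 2 - sigma2 * N) + sigma2 * N ^+ 2 = N * q ^+ 2 by ring.
by field; rewrite Nq mulf_neq0 ?expf_neq0 ?q0 ?gt_eqF.
Qed.

(** In units of [sigma / Num.sqrt N], with [W] the standardized [q], the error is [z - W^-1] when
    the coordinate is kept, where [W^-1 ^+ 2 <= 1], and [z - W] up to sign when it is cut, where
    [W ^+ 2 <= 1 + zstar]. The square of a difference is at most twice the sum of the squares. *)
Lemma threshold_error (sigma zstar N q b z : R) : 0 < sigma -> 0 <= zstar -> 0 < N ->
  q = N * b + sigma * Num.sqrt N * z ->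
  ((if sigma ^+ 2 * (1 + zstar) * N < q ^+ 2
    then (q ^+ 2 - sigma ^+ 2 * N) / (N * q) else 0) - b) ^+ 2 <=
  sigma ^+ 2 / N * (2 * (1 + zstar) + 2 * z ^+ 2).
Proof.
move=> s0 z0 N0; rewrite -{1 3 4 5 6}(sqr_sqrtr (ltW N0)).
have : 0 < Num.sqrt N by rewrite sqrtr_gt0.
move: (Num.sqrt N) => r r0 {N N0}.
pose W := r * b / sigma + z.
have bE : b = sigma / r * (W - z) by rewrite /W; field; rewrite !gt_eqF.
have sr : 0 < sigma / r by rewrite divr_gt0.
move: W bE => W -> {b} qE.
have {qE}-> : q = sigma * r * W by rewrite qE; field; rewrite gt_eqF.
have -> : (sigma ^+ 2 * (1 + zstar) * r ^+ 2 < (sigma * r * W) ^+ 2) = (1 + zstar < W ^+ 2).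
  have -> : sigma ^+ 2 * (1 + zstar) * r ^+ 2 = (sigma * r) ^+ 2 * (1 + zstar) by ring.
  by rewrite [ltRHS]exprMn ltr_pM2l// exprn_gt0// mulr_gt0.
rewrite -[sigma ^+ 2 / r ^+ 2]expr_div_n.
case: ltP => [hW|hW].
  have W0 : W != 0 by apply: contraTneq hW => ->; rewrite expr0n/= -leNgt; lra.
  have -> : ((sigma * r * W) ^+ 2 - sigma ^+ 2 * r ^+ 2) / (r ^+ 2 * (sigma * r * W)) -
     sigma / r * (W - z) = sigma / r * (z - W^-1) by field; rewrite W0 !gt_eqF.
  rewrite exprMn ler_pM2l ?exprn_gt0//.
  have : W^-1 ^+ 2 <= 1 by rewrite exprVn invf_le1 ?(lt_le_trans _ (ltW hW))//; lra.
  have := sqr_ge0 (z + W^-1); nra.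
rewrite sub0r sqrrN exprMn ler_pM2l ?exprn_gt0//.
have := sqr_ge0 (z + W); nra.
Qed.

(** The standardized [q] is now [z] itself; a kept coordinate has squared error
    [z ^+ 2 - 2 + z^-1 ^+ 2], and [z ^+ 2 > 1] bounds the last term by 1. *)
Lemma threshold_error0 (sigma zstar N q z : R) : 0 < sigma -> 0 <= zstar -> 0 < N ->
  q = sigma * Num.sqrt N * z ->
  (if sigma ^+ 2 * (1 + zstar) * N < q ^+ 2
    then (q ^+ 2 - sigma ^+ 2 * N) / (N * q) else 0) ^+ 2 <=
  sigma ^+ 2 / N * (if 1 + zstar < z ^+ 2 then z ^+ 2 - 1 else 0).
Proof.
move=> s0 z0 N0; rewrite -{2 3 4 5}(sqr_sqrtr (ltW N0)).
have : 0 < Num.sqrt N by rewrite sqrtr_gt0.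
move: (Num.sqrt N) => r r0 {N N0} ->.
have sr : 0 < sigma / r by rewrite divr_gt0.
have -> : (sigma ^+ 2 * (1 + zstar) * r ^+ 2 < (sigma * r * z) ^+ 2) = (1 + zstar < z ^+ 2).
  have -> : sigma ^+ 2 * (1 + zstar) * r ^+ 2 = (sigma * r) ^+ 2 * (1 + zstar) by ring.
  by rewrite [ltRHS]exprMn ltr_pM2l// exprn_gt0// mulr_gt0.
rewrite -[sigma ^+ 2 / r ^+ 2]expr_div_n.
case: ltP => [hz|_]; last by rewrite expr0n/= mulr0.
have zn0 : z != 0 by apply: contraTneq hz => ->; rewrite expr0n/= -leNgt; lra.
have -> : ((sigma * r * z) ^+ 2 - sigma ^+ 2 * r ^+ 2) / (r ^+ 2 * (sigma * r * z)) =
   sigma / r * (z - z^-1) by field; rewrite zn0 !gt_eqF.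
rewrite exprMn ler_pM2l ?exprn_gt0// sqrrB mulfV//.
have : z^-1 ^+ 2 <= 1 by rewrite exprVn invf_le1 ?(lt_le_trans _ (ltW hz))//; lra.
lra.
Qed.

End closed_form.

(* On [sqrt a < `|r|], one of the two exponentials with slope [(1 - 2 * lam) * sqrt a],
   the optimal Chernoff slope, makes up for the factor [expR (- (1 - 2 * lam) * a)]. *)
Lemma expR_threshold_le (R : realType) (lam a r : R) : 0 <= lam -> 0 <= a -> 2 * lam <= 1 ->
  expR (lam * (if a < r ^+ 2 then r ^+ 2 - 1 else 0)) <=
  1 + expR (- lam - (1 - 2 * lam) * a) *
      (expR (lam * r ^+ 2 + (1 - 2 * lam) * Num.sqrt a * r) +
       expR (lam * r ^+ 2 + - ((1 - 2 * lam) * Num.sqrt a) * r)).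
Proof.
move=> l0 a0 l1.
case: ltP => [ar|_]; last first.
  by rewrite mulr0 expR0 lerDl mulr_ge0 ?addr_ge0 ?expR_ge0.
have v0 : 0 <= 1 - 2 * lam by lra.
have t0 := sqrtr_ge0 a; have := sqr_sqrtr a0.
move: (Num.sqrt a) t0 => t t0 ta.
have tr : t <= `|r|.
  by rewrite -(@ler_pXn2r _ 2%N)// ?nnegrE// real_normK ?num_real// ta ltW.
rewrite [in leRHS]mulrDr -!expRD.
have H : expR (lam * (r ^+ 2 - 1)) <=
    expR (- lam - (1 - 2 * lam) * a + (lam * r ^+ 2 + (1 - 2 * lam) * t * `|r|)).
  have := mulr_ge0 (mulr_ge0 v0 t0) (_ : 0 <= `|r| - t); rewrite subr_ge0 => /(_ tr).
  by rewrite ler_expR -ta; nra.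
apply: (le_trans H); rewrite -[leLHS]add0r lerD//.
have [r0|r0] := leP 0 r.
  by rewrite ger0_norm// lerDl expR_ge0.
by rewrite ltr0_norm// mulrN mulNr lerDr expR_ge0.
Qed.

(** * Chernoff bound for the standardized error *)

Section tail.
Context (d : measure_display) (T : measurableType d) (R : realType).
Variables (P : probability T R) (n p : nat) (sigma : R) (eps : 'I_n -> {RV P >-> R}).
Hypotheses (s0 : 0 < sigma) (Neps : forall i, normal_rv P sigma (eps i)).
Hypothesis indep : mutually_independent P (fun i => (eps i : T -> R)).
Variable u : 'I_n -> 'I_p -> R.
Hypothesis uu : forall j k, \sum_i u i j * u i k = (j == k)%:R / sigma ^+ 2.
Let z j (w : T) := \sum_i u i j * eps i w.

Lemma measurable_orthonormal_comb j : measurable_fun setT (z j).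
Proof.
by apply: measurable_sum => i; apply: measurable_funM => //; exact: measurable_funPT.
Qed.

Lemma measurable_threshold_sum (S : {set 'I_p}) (L : R) :
  measurable_fun setT (fun w => \sum_j (if j \in S then 2 * z j w ^+ 2
      else if 1 + 2 * L < z j w ^+ 2 then z j w ^+ 2 - 1 else 0)).
Proof.
have mz := measurable_orthonormal_comb.
apply: measurable_sum => j; have [jS|jS] := boolP (j \in S).
  by apply: measurable_funM => //; exact: measurable_funX.
apply: measurable_fun_ifT => //.
  by apply: measurable_fun_ltr => //; exact: measurable_funX.
by apply: measurable_funB => //; exact: measurable_funX.
Qed.

Lemma orthonormal_tail (S : {set 'I_p}) (lam L B : R) :
  0 <= lam -> 4 * lam < 1 -> 0 <= L ->
  (P [set w | (B < \sum_j (if j \in S then 2 * z j w ^+ 2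
      else if 1 + 2 * L < z j w ^+ 2 then z j w ^+ 2 - 1 else 0))%R] <=
   (expR (- (lam * B)) * ((Num.sqrt (1 - 4 * lam))^-1 ^+ #|S| *
    (1 + 2 * ((Num.sqrt (1 - 2 * lam))^-1 * expR (2 * lam * L - L - 2^-1)))
      ^+ #|~: S|))%:E)%E.
Proof.
move=> l0 l1 L0.
pose F w := \sum_j (if j \in S then 2 * z j w ^+ 2
  else if 1 + 2 * L < z j w ^+ 2 then z j w ^+ 2 - 1 else 0).
rewrite -[X in P X]/[set w | B < F w].
have mz := measurable_orthonormal_comb.
have l2 : 2 * lam < 1 by lra.
have a0 : 0 <= 1 + 2 * L by lra.
pose a := 1 + 2 * L; pose b := (1 - 2 * lam) * Num.sqrt a.
pose K := expR (- lam - (1 - 2 * lam) * a).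
pose q (c e r : R) := expR (c * r ^+ 2 + e * r).
have q0 c e r : 0 <= q c e r by exact: expR_ge0.
have mq c e : measurable_fun setT (q c e).
  apply: measurableT_comp => //.
  by apply: measurable_funD; apply: measurable_funM => //; exact: measurable_funX.
(* On [S] the factor is the exponential of [lam] times the summand; off [S] it is the majorant from
   [expR_threshold_le] at [a = 1 + 2 * L], a positive combination of exponentials of quadratics. *)
pose phi (j : 'I_p) r := if j \in S then q (2 * lam) 0 r else 1 + K * (q lam b r + q lam (- b) r).
pose m (j : 'I_p) := if j \in S then (Num.sqrt (1 - 4 * lam))^-1 else
  1 + 2 * ((Num.sqrt (1 - 2 * lam))^-1 * expR (2 * lam * L - L - 2^-1)).
have Hphi j : [/\ forall r, 0 <= phi j r, measurable_fun setT (phi j), 0 <= m j &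
     mgf_dominated P (z j) (phi j) (m j)].
  rewrite /phi /m; case: ifP => _; split.
  - by [].
  - exact: mq.
  - by rewrite invr_ge0.
  - have l4 : 2 * (2 * lam) < 1 by lra.
    have := @mgf_dominated_expR_sqr _ _ _ P (z j) (mz j) (2 * lam) 0 (mulr_ge0 (ler0n _ 2) l0) l4.
    by rewrite expr0n/= mul0r expR0 mulr1 mulrA -natrM.
  - by move=> r; rewrite addr_ge0// mulr_ge0 ?expR_ge0// addr_ge0.
  - apply: measurable_funD => //; apply: measurable_funM => //; exact: measurable_funD.
  - by rewrite addr_ge0// mulr_ge0// mulr_ge0 ?expR_ge0// invr_ge0.
  - have H1 := @mgf_dominated_expR_sqr _ _ _ P (z j) (mz j) lam b l0 l2.
    have H2 := @mgf_dominated_expR_sqr _ _ _ P (z j) (mz j) lam (- b) l0 l2.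
    have H := mgf_dominatedD (mz j) (q0 lam b) (mq lam b) (q0 lam (- b)) (mq lam (- b)) H1 H2.
    have K0 : 0 <= K by exact: expR_ge0.
    have qq0 r : 0 <= q lam b r + q lam (- b) r by rewrite addr_ge0.
    have mqq : measurable_fun setT (fun r => q lam b r + q lam (- b) r) by exact: measurable_funD.
    have KH := mgf_dominatedZ (mz j) K0 qq0 mqq H.
    have Kqq0 r : 0 <= K * (q lam b r + q lam (- b) r) by rewrite mulr_ge0.
    have mKqq : measurable_fun setT (fun r => K * (q lam b r + q lam (- b) r)).
      exact: measurable_funM.
    have := mgf_dominatedD (mz j) (fun=> ler01) (measurable_cst _) Kqq0 mKqq
      (@mgf_dominated1 _ _ _ P (z j)) KH.
    congr mgf_dominated; congr (1 + _).
    (* The slopes [b] and [- b] give the same constant, and half of [(1 - 2 * lam) * a] cancels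
       between [K] and that constant. *)
    have -> : expR (2 * lam * L - L - 2^-1) = K * expR (b ^+ 2 / (2 * (1 - 2 * lam))).
      rewrite /K -expRD; congr expR; rewrite /b exprMn sqr_sqrtr// /a; field.
      by rewrite gt_eqF//; lra.
    by rewrite sqrrN; ring.
have mF : measurable_fun setT F by exact: measurable_threshold_sum.
have mA : measurable [set w | B < F w].
  have : measurable_fun setT (fun w => B < F w) by exact: measurable_fun_ltr.
  by move=> /(_ measurableT [set true]); rewrite setTI; exact.
have prodm : \prod_j m j = (Num.sqrt (1 - 4 * lam))^-1 ^+ #|S| *
    (1 + 2 * ((Num.sqrt (1 - 2 * lam))^-1 * expR (2 * lam * L - L - 2^-1))) ^+ #|~: S|.
  rewrite /m (bigID (mem S))/=; congr (_ * _).
    by rewrite -prodr_const; apply: eq_bigr => j ->.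
  rewrite -prodr_const; apply: eq_big => [j|j /negbTE->//].
  by rewrite !inE.
rewrite -prodm EFinM.
apply: le_trans; last first.
  apply: lee_wpmul2l; first by rewrite lee_fin expR_ge0.
  exact: (orthonormal_normal_prod s0 Neps indep uu Hphi).
have mphi : measurable_fun setT (fun w => \prod_j phi j (z j w)).
  by apply: measurable_prod => j _; apply: measurableT_comp => //; have [] := Hphi j.
have phi0 w : 0 <= \prod_j phi j (z j w).
  by apply: prodr_ge0 => j _; have [] := Hphi j.
rewrite -ge0_integralZl_EFin//; first last.
- exact/measurable_EFinP.
- by move=> w _; rewrite lee_fin; exact: phi0.
rewrite -[X in P X]setIT -integral_indic//.
apply: ge0_le_integral => //.
- by apply/measurable_EFinP; exact: measurable_indic.
- by apply/measurable_EFinP; exact: measurable_funM.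
move=> w _; rewrite -EFinM lee_fin indicE.
have [/set_mem/= wA|_] := boolP (w \in _); last first.
  by rewrite mulr_ge0 ?expR_ge0//; exact: phi0.
have : expR (lam * F w) <= \prod_j phi j (z j w).
  rewrite mulr_sumr expR_sum; apply: ler_prod => j _; rewrite expR_ge0/= /phi.
  case: ifP => _; first by rewrite /q mul0r addr0 mulrCA mulrA.
  by apply: expR_threshold_le => //; lra.
move=> H; rewrite (le_trans _ (ler_wpM2l (expR_ge0 _) H))//.
rewrite -expRD -[leLHS]expR0 ler_expR; nra.
Qed.

End tail.

(** * Numerical constants and the choice of the Chernoff parameter *)

Section numerics.
Context (R : realType).

(** The sixth power of [1 + 1 / 8 <= expR (1 / 8)] already exceeds 2. *)
Lemma expR34_ge2 : 2 <= expR (3 / 4) :> R.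
Proof.
have -> : 3 / 4 = 6%:R * 8^-1 :> R by field.
rewrite expRM_natl; have : 9 / 8 <= expR 8^-1 :> R.
  by apply: le_trans (expR_ge1Dx _); lra.
move: (expR _) => x hx.
have h2 : 81 / 64 <= x ^+ 2 by nra.
rewrite (exprM x 2 3); move: (x ^+ 2) h2 => y hy.
rewrite !exprS expr0 mulr1; have : (16 / 10) <= y * y by nra.
nra.
Qed.

Lemma expR43_ge3 : 3 <= expR (4 / 3) :> R.
Proof.
rewrite expRM_natl; have : 4 / 3 <= expR 3^-1 :> R.
  by apply: le_trans (expR_ge1Dx _); lra.
move: (expR _) => x hx.
have h2 : 16 / 9 <= x ^+ 2 by nra.
by rewrite (exprM x 2 2); nra.
Qed.

(** [23 / 24 <= expR (- 1 / 24)] is raised to the power 32 by repeated squaring, rounding down each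
    time. *)
Lemma expR43_le4 : expR (4 / 3) <= 4 :> R.
Proof.
suff : 4^-1 <= expR (- (4 / 3)) :> R.
  by rewrite expRN lef_pV2 ?posrE ?expR_gt0.
have -> : - (4 / 3) = 32%:R * - (24^-1) :> R by field.
rewrite expRM_natl; have : 23 / 24 <= expR (- 24^-1) :> R.
  by apply: le_trans (expR_ge1Dx _); lra.
move: (expR _) => x0 h0.
have h1 : (918 / 1000) <= x0 ^+ 2 by nra.
rewrite (exprM x0 2 16); move: (x0 ^+ 2) h1 => x1 h1.
have h2 : (842 / 1000) <= x1 ^+ 2 by nra.
rewrite (exprM x1 2 8); move: (x1 ^+ 2) h2 => x2 h2.
have h3 : (708 / 1000) <= x2 ^+ 2 by nra.
rewrite (exprM x2 2 4); move: (x2 ^+ 2) h3 => x3 h3.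
have h4 : (501 / 1000) <= x3 ^+ 2 by nra.
by rewrite (exprM x3 2 2); nra.
Qed.

Lemma ge3_of_ln_ge1 (s : nat) : 1 <= ln (s%:R : R) -> (3 <= s)%N.
Proof.
move=> h; have s1 : 1 < s%:R :> R.
  by rewrite ltNge; apply/negP => /ln_le0; lra.
have : expR 1 <= s%:R :> R.
  by rewrite -[leRHS]lnK ?ler_expR// posrE; lra.
have : 1 + 1 < expR 1 :> R by apply: expR_gt1Dx.
move=> h2 h3; have : 2%:R < s%:R :> R by lra.
by rewrite ltr_nat.
Qed.

(* [12 * L - 2] is what the budget [4 * (2 + c0) * L] leaves, at the worst case [c0 = 2],
   after the deterministic part [2 * (1 + c0 * L)].  With [lam = 1 / (4 * L)] the factors
   off the support are of size [1 + O(1 / p)]; it requires [L] bounded away from 1, which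
   may fail only if [p = s], and there are then no such factors. *)
Lemma exponent_choice (s p : nat) : (s <= p)%N -> 1 <= ln (s%:R : R) ->
  let L := ln (p%:R : R) in
  exists lam : R, [/\ 0 <= lam, 4 * lam < 1 &
   expR (- (lam * ((12 * L - 2) * s%:R))) * ((Num.sqrt (1 - 4 * lam))^-1 ^+ s *
    (1 + 2 * ((Num.sqrt (1 - 2 * lam))^-1 * expR (2 * lam * L - L - 2^-1)))
      ^+ (p - s)) <= expR (- s%:R)].
Proof.
move=> sp hs L.
have s3 := ge3_of_ln_ge1 hs.
have s3R : 3 <= s%:R :> R by rewrite ler_nat.
have p0 : 0 < p%:R :> R by rewrite ltr0n (leq_trans _ sp)// (leq_trans _ s3).
have pE : expR L = p%:R by rewrite lnK.
have L1 : 1 <= L.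
  apply: (le_trans hs); rewrite ler_ln ?posrE ?ler_nat//.
  by rewrite (lt_le_trans _ s3R).
have Ln0 : L != 0 by rewrite gt_eqF//; lra.
have invL1 : L^-1 <= 1 by rewrite invf_le1//; lra.
have invL0 : 0 < L^-1 by rewrite invr_gt0; lra.
have [ps|ps] := leqP p s.
  have -> : (p - s = 0)%N by apply/eqP; rewrite subn_eq0.
  (* Here [p = s] and only [L >= 1] is known; at [L = 1] the value [1 / (4 * L)] would make
     [1 - 4 * lam] vanish. With [1 / (6 * L)] it stays at least [1 / 3], and the exponent per
     coordinate is at least [5 / 3 - 2 / 3 = 1]. *)
  exists (L^-1 / 6); split; [nra|nra|].
  rewrite expr0 mulr1.
  have H1 : expR (- (L^-1 / 6 * ((12 * L - 2) * s%:R))) <= expR (- (5 / 3)) ^+ s.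
    rewrite -expRM_natl ler_expR.
    have -> : L^-1 / 6 * ((12 * L - 2) * s%:R) = s%:R * (2 - L^-1 / 3) by field.
    nra.
  have H2 : (Num.sqrt (1 - 4 * (L^-1 / 6)))^-1 <= expR (2 / 3).
    rewrite -[leRHS]invrK -expRN lef_pV2 ?posrE ?expR_gt0// ?sqrtr_gt0; last by lra.
    rewrite -(@ler_pXn2r _ 2%N)// ?nnegrE ?expR_ge0// sqr_sqrtr; last by lra.
    rewrite -expRM_natl; have -> : 2%:R * - (2 / 3) = - (4 / 3) :> R by field.
    apply: (@le_trans _ _ 3^-1); last by lra.
    by rewrite expRN lef_pV2 ?posrE ?expR_gt0// expR43_ge3.
  have H3 : (Num.sqrt (1 - 4 * (L^-1 / 6)))^-1 ^+ s <= expR (2 / 3) ^+ s.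
    by rewrite lerXn2r ?nnegrE ?expR_ge0// invr_ge0.
  apply: (le_trans (ler_pM (expR_ge0 _) _ H1 H3)); first by rewrite exprn_ge0// invr_ge0.
  rewrite -exprMn -expRD -expRM_natl ler_expR; nra.
have p4 : 4 <= p%:R :> R by rewrite (ler_nat _ 4) (leq_trans _ ps).
have L43 : 4 / 3 <= L.
  by rewrite -ler_expR pE (le_trans expR43_le4).
have invL34 : L^-1 <= 3 / 4.
  by rewrite -[leRHS]invrK lef_pV2 ?posrE//; lra.
(* Now [1 - 4 * lam >= 1 / 4], so a coordinate of the support costs at most [2 <= expR (3 / 4)]
   against a gain of [expR (21 / 8)]. *)
exists (L^-1 / 4); split; [nra|nra|].
have -> : 2 * (L^-1 / 4) * L - L - 2^-1 = - L by field.
rewrite (expRN L) pE.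
have H1 : expR (- (L^-1 / 4 * ((12 * L - 2) * s%:R))) <= expR (- (21 / 8)) ^+ s.
  rewrite -expRM_natl ler_expR.
  have -> : L^-1 / 4 * ((12 * L - 2) * s%:R) = s%:R * (3 - L^-1 / 2) by field.
  nra.
have H2 : (Num.sqrt (1 - 4 * (L^-1 / 4)))^-1 <= expR (3 / 4).
  apply: le_trans expR34_ge2.
  rewrite -[leRHS]invrK lef_pV2 ?posrE ?invr_gt0// ?sqrtr_gt0; last by lra.
  rewrite -(@ler_pXn2r _ 2%N)// ?nnegrE// ?invr_ge0// sqr_sqrtr; lra.
have H3 : (Num.sqrt (1 - 4 * (L^-1 / 4)))^-1 ^+ s <= expR (3 / 4) ^+ s.
  by rewrite lerXn2r ?nnegrE ?expR_ge0// invr_ge0.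
have H4 : (Num.sqrt (1 - 2 * (L^-1 / 4)))^-1 <= (13 / 10).
  rewrite -[leRHS]invrK lef_pV2 ?posrE ?invr_gt0// ?sqrtr_gt0; [|lra].
  rewrite -(@ler_pXn2r _ 2%N)// ?nnegrE// ?invr_ge0.
  rewrite sqr_sqrtr; lra.
(* Each factor is at most [1 + (26 / 10) / p] and there are fewer than [p] of them, so together they
   cost a constant. *)
have H5 : (1 + 2 * ((Num.sqrt (1 - 2 * (L^-1 / 4)))^-1 * p%:R^-1)) ^+ (p - s) <= expR (26 / 10).
  apply: (@le_trans _ _ (expR ((26 / 10) / p%:R) ^+ (p - s))).
    apply: lerXn2r; rewrite ?nnegrE ?expR_ge0//.
    apply: le_trans (expR_ge1Dx _); rewrite lerD2l mulrA.
    by rewrite ler_pM2r ?invr_gt0//; lra.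
  rewrite -expRM_natl ler_expR mulrA ler_pdivrMr// mulrC ler_pM2l; last by lra.
  by rewrite ler_nat leq_subr.
have X0 : 0 <= (Num.sqrt (1 - 4 * (L^-1 / 4)))^-1 ^+ s by rewrite exprn_ge0// invr_ge0.
have Y0 : 0 <= (1 + 2 * ((Num.sqrt (1 - 2 * (L^-1 / 4)))^-1 * p%:R^-1)) ^+ (p - s).
  by rewrite exprn_ge0// addr_ge0// mulr_ge0// mulr_ge0 ?invr_ge0// ltW.
apply: (le_trans (ler_pM (expR_ge0 _) (mulr_ge0 X0 Y0) H1 (ler_pM X0 Y0 H3 H5))).
(* It remains that [26 / 10 <= 7 / 8 * s], which holds narrowly from [s >= 3]. *)
rewrite mulrA -exprMn -expRD -expRM_natl -expRD ler_expR; nra.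
Qed.

End numerics.

(** * Measurability and the deterministic error bound *)

Lemma measurable_threshold (R : realType) (K M N : R) : 0 <= K ->
  measurable_fun setT (fun q : R => if K < q ^+ 2 then (q ^+ 2 - M) / (N * q) else 0).
Proof.
move=> K0.
(* [q^-1] is rewritten as [q * expR (- ln (q ^+ 2))], whose measurability is available. *)
rewrite (_ : (fun q => _) = fun q : R =>
    if K < q ^+ 2 then (q ^+ 2 - M) * N^-1 * (q * expR (- ln (q ^+ 2))) else 0).
  have mX : measurable_fun setT (fun q : R => q ^+ 2) by exact: measurable_funX.
  apply: measurable_fun_ifT => //; first exact: measurable_fun_ltr.
  apply: measurable_funM.
    by apply: measurable_funM => //; exact: measurable_funB.
  apply: measurable_funM => //; apply: measurableT_comp => //.
  apply: measurable_funN; apply: measurableT_comp => //; exact: measurable_ln.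
apply/funext => q; case: ltP => // Kq.
have q2 : 0 < q ^+ 2 by exact: le_lt_trans Kq.
have q0 : q != 0 by apply: contraTneq q2 => ->; rewrite expr0n ltxx.
rewrite expRN lnK ?posrE// invfM [LHS]mulrA; congr (_ * _).
by rewrite expr2 invfM mulrA mulfV// mul1r.
Qed.

Lemma colinner_linear_model (R : realType) n p (X : 'M[R]_(n, p)) (b : 'cV[R]_p)
    (e : 'I_n -> R) j : orthogonal_nonzero_cols X ->
  colinner X j (X *m b + \col_(i < n) e i) =
  colnorm2 X j * b j 0 + \sum_i X i j * e i.
Proof.
move=> [_ hX]; rewrite /colinner.
under eq_bigr do rewrite !mxE mulrDr.
rewrite big_split/=; congr (_ + _).
under eq_bigr do rewrite mulr_sumr.
rewrite exchange_big/= (bigD1 j)//= [X in _ + X]big1 ?addr0.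
  by rewrite mulr_suml; apply: eq_bigr => i _; rewrite mulrA expr2.
move=> k kj; under eq_bigr do rewrite mulrA.
by rewrite -mulr_suml hX ?mul0r// eq_sym.
Qed.

Lemma cmin_le (R : realType) n p (X : 'M[R]_(n, p)) j : cmin X <= colnorm2 X j / n%:R.
Proof. by rewrite /cmin (bigD1 j)//= ge_min lexx. Qed.

Lemma cmin_gt0 (R : realType) n p (X : 'M[R]_(n, p)) : (0 < n)%N -> (0 < p)%N ->
  orthogonal_nonzero_cols X -> 0 < cmin X.
Proof.
move=> n0 p0 hX.
have N0 j : 0 < colnorm2 X j / n%:R by rewrite divr_gt0 ?ltr0n// colnorm2_gt0.
rewrite /cmin; elim/big_ind: _ => //.
(* The default value of the minimum has to be positive as well; it contains a positive term because
   [p > 0]. *)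
- rewrite (bigD1 (Ordinal p0))//= ltr_wpDr//.
  by apply: sumr_ge0 => j _; exact: ltW.
- by move=> x y x0 y0; rewrite lt_min x0.
Qed.

(** Deterministic part: an error above the claimed bound forces the standardized contributions above
    the budget used in the tail estimate. *)
Lemma sum_threshold_error (R : realType) n p (X : 'M[R]_(n, p)) (b : 'cV[R]_p)
    (e : 'I_n -> R) (sigma c0 L : R) :
  orthogonal_nonzero_cols X -> 0 < sigma -> 2 < c0 -> 0 < L -> (0 < n)%N ->
  let S := [set j : 'I_p | b j 0 != 0]%SET in
  let z j := \sum_i X i j / (sigma * Num.sqrt (colnorm2 X j)) * e i in
  4 * (2 + c0) / cmin X * (sigma ^+ 2 * #|S|%:R * L / n%:R) <
    \sum_j (beta_tilde (sigma ^+ 2) (c0 * L) X (X *m b + \col_(i < n) e i) j 0 - b j 0) ^+ 2 ->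
  (12 * L - 2) * #|S|%:R <
    \sum_j (if j \in S then 2 * z j ^+ 2
            else if 1 + 2 * L < z j ^+ 2 then z j ^+ 2 - 1 else 0).
Proof.
move=> hX s0 c2 L0 n0 S z Hlt.
have [p0|p0] := posnP p.
  (* Without columns [cmin X] is an empty sum, so it and its inverse are 0 and both sides of [Hlt]
     vanish. *)
  by subst p; move: Hlt; rewrite /cmin !big_ord0 invr0 mulr0 mul0r ltxx.
have c_gt0 := cmin_gt0 n0 p0 hX.
have nR : 0 < n%:R :> R by rewrite ltr0n.
have zs0 : 0 <= c0 * L by rewrite mulr_ge0//; lra.
set F := \sum_j (if _ then _ else _).
have H : \sum_j (beta_tilde (sigma ^+ 2) (c0 * L) X (X *m b + \col_(i < n) e i) j 0 - b j 0) ^+ 2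
   <= sigma ^+ 2 / (cmin X * n%:R) * (2 * (1 + c0 * L) * #|S|%:R + F).
  have -> : 2 * (1 + c0 * L) * #|S|%:R + F =
      \sum_j (if j \in S then 2 * (1 + c0 * L) + 2 * z j ^+ 2
            else if 1 + 2 * L < z j ^+ 2 then z j ^+ 2 - 1 else 0).
    rewrite mulr_natr -sumr_const big_mkcond -big_split/=; apply: eq_bigr => j _.
    by case: ifP => _; rewrite ?add0r.
  rewrite mulr_sumr; apply: ler_sum => j _.
  have N0 := colnorm2_gt0 j hX.
  have r0 : 0 < Num.sqrt (colnorm2 X j) by rewrite sqrtr_gt0.
  have qE : colinner X j (X *m b + \col_(i < n) e i) =
      colnorm2 X j * b j 0 + sigma * Num.sqrt (colnorm2 X j) * z j.
    rewrite colinner_linear_model// /z mulr_sumr; congr (_ + _); apply: eq_bigr => i _.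
    by field; rewrite !gt_eqF.
  rewrite beta_tilde_orthogonal ?exprn_gt0//.
  have Ncn : sigma ^+ 2 / colnorm2 X j <= sigma ^+ 2 / (cmin X * n%:R).
    by rewrite ler_pM2l ?exprn_gt0// lef_pV2 ?posrE ?mulr_gt0// -ler_pdivlMr// cmin_le.
  have [jS|jS] := boolP (j \in S).
    apply: (le_trans (threshold_error s0 zs0 N0 qE)).
    by rewrite ler_wpM2r// addr_ge0// mulr_ge0 ?sqr_ge0//; lra.
  have bj : b j 0 = 0 by apply/eqP; move: jS; rewrite /S inE negbK.
  move: qE; rewrite bj mulr0 add0r subr0 => qE.
  apply: (le_trans (threshold_error0 s0 zs0 N0 qE)).
  have t0 : 0 <= (if 1 + c0 * L < z j ^+ 2 then z j ^+ 2 - 1 else 0).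
    by case: ltP => // h; lra.
  apply: (le_trans (ler_wpM2r t0 Ncn)); rewrite ler_wpM2l//.
    by rewrite divr_ge0 ?sqr_ge0// mulr_ge0// ltW.
  (* Lowering the threshold from [1 + c0 * L] to [1 + 2 * L] only adds nonnegative terms and frees
     the tail bound from [c0]. *)
  have cL : 2 * L <= c0 * L by rewrite ler_wpM2r ?ltW.
  case: ltP => h1; case: ltP => h2 //; lra.
have K0 : 0 < sigma ^+ 2 / (cmin X * n%:R) by rewrite divr_gt0 ?exprn_gt0 ?mulr_gt0.
have := lt_le_trans Hlt H.
rewrite (_ : 4 * (2 + c0) / cmin X * (sigma ^+ 2 * #|S|%:R * L / n%:R) =
  sigma ^+ 2 / (cmin X * n%:R) * (4 * (2 + c0) * L * #|S|%:R)); last first.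
  by field; rewrite !gt_eqF.
rewrite ltr_pM2l//.
have : 0 <= #|S|%:R :> R by [].
(* The remaining budget per support coordinate is [4 * (2 + c0) * L - 2 * (1 + c0 * L) = 12 * L - 2
   + 2 * (c0 - 2) * L]. *)
have : 0 <= (c0 - 2) * L by rewrite mulr_ge0//; lra.
move: (#|S|%:R : R) => k h1 h2 h3.
have := mulr_ge0 h1 h2; nra.
Qed.

(** * From the tail bound to the probability of the error event *)

Unset Implicit Arguments. Set Strict Implicit.

Theorem theorem1 (R : realType) (d : measure_display) (T : measurableType d)
  (P : probability T R) (n p : nat) (X : 'M[R]_(n, p)) (beta_star : 'cV[R]_p)
  (sigma : R) (eps : 'I_n -> {RV P >-> R}) (c0 : R) :
  0 < sigma ->
  (forall i, normal_rv P sigma (eps i)) ->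
  mutually_independent P (fun i => (eps i : T -> R)) ->
  orthogonal_nonzero_cols X ->
  let s := #|[set j : 'I_p | beta_star j 0 != 0]| in
  1 <= ln (s%:R : R) ->
  2 < c0 ->
  let zstar := c0 * ln (p%:R : R) in
  let c := cmin X in
  let M := 4 * (2 + c0) / c in
  let Y : T -> 'cV[R]_n := fun w => X *m beta_star + \col_(i < n) eps i w in
  (P [set w | (\sum_(j < p) (beta_tilde (sigma ^+ 2) zstar X (Y w) j 0
                               - beta_star j 0) ^+ 2
              <= M * (sigma ^+ 2 * s%:R * ln (p%:R : R) / n%:R))%R]
   >= (1 - (p%:R : R) `^ (- (c0 * s%:R / 8)) - expR (- s%:R))%:E)%E.
Proof.
move=> s0 Neps indep hX s hs c2; cbv zeta.
set zstar := c0 * ln _.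
set Y := fun w : T => X *m beta_star + \col_(i < n) eps i w.
(* The support in the statement is a classical set; [S] is its finite-set counterpart, needed for
   cardinalities and sums. *)
pose S := [set j : 'I_p | beta_star j 0 != 0]%SET.
have sS : s = #|S|.
  by apply: eq_card => j; rewrite inE; apply/idP/idP => [/set_mem|h]//; apply/mem_set.
have sp : (s <= p)%N by rewrite sS -[leqRHS]card_ord max_card.
have s3 := ge3_of_ln_ge1 hs.
have p0 : (0 < p)%N by rewrite (leq_trans _ sp)// (leq_trans _ s3).
have [lam [lam0 lam4 Hlam]] := exponent_choice sp hs.
set L := ln (p%:R : R) in zstar Hlam *.
have L1 : 1 <= L.
  have s0R : 0 < s%:R :> R by rewrite ltr0n (leq_trans _ s3).
  by apply: (le_trans hs); rewrite ler_ln ?posrE ?ler_nat// ltr0n.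
have n0 : (0 < n)%N.
  have /= := colnorm2_gt0 (Ordinal p0) hX.
  by rewrite lt0n; apply: contraTneq => n0; subst n; rewrite /colnorm2 big_ord0 ltxx.
pose r j := sigma * Num.sqrt (colnorm2 X j).
have r0 j : r j != 0 by rewrite gt_eqF// mulr_gt0// sqrtr_gt0 colnorm2_gt0.
(* The normalized columns are orthogonal with squared norm [1 / sigma ^+ 2], which standardizes
   their inner products with the noise. *)
have uu j k : \sum_i X i j / r j * (X i k / r k) = (j == k)%:R / sigma ^+ 2.
  under eq_bigr do rewrite mulrACA.
  rewrite -mulr_suml; have [<-|jk] := eqVneq j k; last by rewrite hX.2// !mul0r.
  under eq_bigr do rewrite -expr2.
  rewrite -/(colnorm2 X j) -invfM -expr2 /r exprMn sqr_sqrtr ?(ltW (colnorm2_gt0 _ hX))//=.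
  by field; rewrite !gt_eqF// colnorm2_gt0.
set A := [set w | _].
pose B := [set w | (12 * L - 2) * #|S|%:R <
  \sum_j (if j \in S then 2 * (\sum_i X i j / r j * eps i w) ^+ 2
          else if 1 + 2 * L < (\sum_i X i j / r j * eps i w) ^+ 2
               then (\sum_i X i j / r j * eps i w) ^+ 2 - 1 else 0)].
have L0 : 0 < L by exact: lt_le_trans L1.
have zs0 : 0 <= zstar.
  by rewrite mulr_ge0 ?(ltW L0)// (le_trans _ (ltW c2)).
have mcol j : measurable_fun setT (fun w => colinner X j (Y w)).
  under eq_fun do rewrite colinner_linear_model//.
  apply: measurable_funD => //; apply: measurable_sum => i.
  by apply: measurable_funM => //; exact: measurable_funPT.
(* Measurability is read off the closed form, where each coordinate is a function of one inner
   product and no matrix inverse appears. *)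
have mA : measurable A.
  have mF : measurable_fun setT (fun w => \sum_j (beta_tilde (sigma ^+ 2) zstar X (Y w) j 0
                               - beta_star j 0) ^+ 2).
    apply: measurable_sum => j; apply: measurable_funX; apply: measurable_funB => //.
    under eq_fun do rewrite beta_tilde_orthogonal ?exprn_gt0//.
    apply: (measurableT_comp (measurable_threshold _ _ _) (mcol j)).
    by rewrite !mulr_ge0 ?sqr_ge0 ?addr_ge0// ltW// colnorm2_gt0.
  rewrite /A; have := measurable_fun_ler mF (measurable_cst
    (4 * (2 + c0) / cmin X * (sigma ^+ 2 * s%:R * L / n%:R))).
  by move=> /(_ measurableT [set true]); rewrite setTI; exact.
have mB : measurable B.
  have := measurable_fun_ltr (measurable_cst ((12 * L - 2) * #|S|%:R))
    (measurable_threshold_sum eps (fun i j => X i j / r j) S L).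
  by move=> /(_ measurableT [set true]); rewrite setTI; exact.
have AB : ~` A `<=` B.
  move=> w /= /negP; rewrite -ltNge => h.
  rewrite sS in h.
  exact: (sum_threshold_error hX s0 c2 L0 n0 h).
have PB : (P B <= (expR (- s%:R))%:E)%E.
  have cS : #|~: S|%SET = (p - s)%N.
    by apply/eqP; rewrite sS -(eqn_add2l #|S|) cardsC card_ord subnKC// -sS.
  apply: le_trans (orthonormal_tail s0 Neps indep uu S _ lam0 lam4 (ltW L0)) _.
  by rewrite lee_fin cS -sS; exact: Hlam.
have : (P (~` A) <= (expR (- s%:R))%:E)%E.
  exact: le_trans (le_measure P (mem_set (measurableC mA)) (mem_set mB) AB) PB.
rewrite probability_setC// -(fineK (fin_num_measure P A mA)) -EFinB !lee_fin.
(* The power of [p] is nonnegative, so subtracting it only lowers the bound to be reached. *)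
have := powR_ge0 (p%:R : R) (- (c0 * s%:R / 8)).
by move: (fine _) (_ `^ _) (expR _) => x y e; lra.
Qed.
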